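(* Let $L,M$ be locales and let $f\colon L\to M$ be an arbitrary function. Define $f_{\mathfrak c}^{\to},f_{\mathfrak c}^{\Rightarrow}\colon \mathfrak c L\to\mathfrak c M$ by $f_{\mathfrak c}^{\to}(\mathfrak c(a))=\mathrm{cl}(f[\mathfrak c(a)])$ and $f_{\mathfrak c}^{\Rightarrow}(\mathfrak c(a))=\big(\mathrm{int}(f[\mathfrak o(a)])\big)^{\mathsf c}$, and $f_{\mathfrak c}^{\leftarrow}\colon \mathfrak c M\to\mathfrak c L$ by $f_{\mathfrak c}^{\leftarrow}(\mathfrak c(b))=\mathrm{cl}(f^{-1}[\mathfrak c(b)])$. Then $f$ is an open localic map if and only if $f_{\mathfrak c}^{\to}\dashv f_{\mathfrak c}^{\leftarrow}\dashv f_{\mathfrak c}^{\Rightarrow}$.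
   Context: A locale (= frame) is a complete lattice $L$ with $(\bigvee A)\wedge b=\bigvee\{a\wedge b\mid a\in A\}$ for all $A\subseteq L$, $b\in L$; it has a Heyting operation $\to$ with $a\wedge b\le c\iff a\le b\to c$. A frame homomorphism preserves all joins and all finite meets (including $0$ and $1$). A localic map $f\colon L\to M$ is a right adjoint of a frame homomorphism $M\to L$. For $a\in L$: $\mathfrak c(a)=\{x\in L\mid x\ge a\}$ (closed sublocale), $\mathfrak o(a)=\{x\in L\mid a\to x=x\}$ (open sublocale). Complements $(-)^{\mathsf c}$ are taken in the lattice of sublocales, so $\mathfrak c(a)^{\mathsf c}=\mathfrak o(a)$ and $\mathfrak o(a)^{\mathsf c}=\mathfrak c(a)$. $\mathfrak c L=\{\mathfrak c(a)\mid a\in L\}$, ordered by inclusion. For any subset $S\subseteq L$, $\mathrm{cl}\,S=\mathfrak c(\bigwedge S)$ and $\mathrm{int}\,S=\mathfrak o(\bigvee\{a\in L\mid \mathfrak o(a)\subseteq S\})$. A map $f\colon L\to M$ is open if for every $a\in L$ the image $f[\mathfrak o(a)]$ is an open sublocale of $M$; an open localic map is a localic map that is open. For posets $X,Y$ and order-preserving maps $g\colon X\to Y$, $h\colon Y\to X$, $g\dashv h$ means $g(x)\le y\iff x\le h(y)$ for all $x\in X$, $y\in Y$. *)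

(* Defs.v *)
From HB Require Import structures.
From mathcomp Require Import all_boot all_order.
From mathcomp Require Import mathcomp_extra boolp classical_sets.

Set Implicit Arguments.
Unset Strict Implicit.
Unset Printing Implicit Defensive.

Import Order.TTheory.
Local Open Scope classical_set_scope.
Local Open Scope order_scope.

HB.mixin Record TBLattice_isComplete d (T : Type) of Order.TBLattice d T := {
  bigjoin : set T -> T ;
  bigjoin_supremum : forall A : set T, supremums A (bigjoin A)
}.

#[short(type="completeLatticeType")]
HB.structure Definition CompleteLattice d :=
  { T of Order.TBLattice d T & TBLattice_isComplete d T }.

HB.mixin Record CompleteLattice_isLocale d (T : Type) of CompleteLattice d T := {
  bigjoin_meetl : forall (A : set T) (b : T),
    bigjoin A `&` b = bigjoin [set a `&` b | a in A]
}.

#[short(type="localeType")]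
HB.structure Definition Locale d :=
  { T of CompleteLattice d T & CompleteLattice_isLocale d T }.

Definition bigmeet d (L : completeLatticeType d) (A : set L) : L :=
  bigjoin (lbound A).

Definition heyting d (L : localeType d) (a b : L) : L :=
  bigjoin [set x | x `&` a <= b].

Section CompleteLatticeTheory.
Context d (L : completeLatticeType d).
Implicit Types (A : set L) (x y : L).

Lemma bigjoin_ub A x : A x -> x <= bigjoin A.
Proof. by move=> Ax; have [+ _] := bigjoin_supremum A; apply. Qed.

Lemma bigjoin_le A y : (forall x, A x -> x <= y) -> bigjoin A <= y.
Proof. by move=> Ay; have [_] := bigjoin_supremum A; apply. Qed.

Lemma bigmeet_lb A x : A x -> bigmeet A <= x.
Proof. by move=> Ax; apply: bigjoin_le => y; apply. Qed.

Lemma bigmeet_ge A y : (forall x, A x -> y <= x) -> y <= bigmeet A.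
Proof. by move=> Ay; apply: bigjoin_ub. Qed.

Lemma bigmeet_infimum A : infimums A (bigmeet A).
Proof.
by split=> [x|y Ay]; [exact: bigmeet_lb | exact: bigmeet_ge].
Qed.

End CompleteLatticeTheory.

Lemma heytingP d (L : localeType d) (a b x : L) :
  (x <= heyting a b) = (x `&` a <= b).
Proof.
apply/idP/idP => [le_x|]; last by move=> ?; exact: bigjoin_ub.
apply: le_trans (leI2 le_x (lexx a)) _.
by rewrite bigjoin_meetl; apply: bigjoin_le => _ [y ? <-].
Qed.

Definition galois dX (X : porderType dX) dY (Y : porderType dY)
    (g : X -> Y) (h : Y -> X) : Prop :=
  forall x y, (g x <= y) <-> (x <= h y).

Lemma galois_homo dX (X : porderType dX) dY (Y : porderType dY)
    (g : X -> Y) (h : Y -> X) :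
  galois g h -> {homo g : x y / x <= y} /\ {homo h : x y / x <= y}.
Proof.
move=> gh; split=> x y xy.
  by apply/gh; apply: le_trans xy _; apply/gh.
by apply/gh; apply: le_trans xy; apply/gh.
Qed.

Definition frame_hom dM (M : localeType dM) dL (L : localeType dL)
    (g : M -> L) : Prop :=
  [/\ forall A : set M, g (bigjoin A) = bigjoin (g @` A),
      g \bot = \bot, g \top = \top & {morph g : x y / x `&` y}].

Definition localic_map dL (L : localeType dL) dM (M : localeType dM)
    (f : L -> M) : Prop :=
  exists2 g : M -> L, frame_hom g & galois g f.

Section Sublocales.
Context d (L : localeType d).
Implicit Types (a b x : L) (S T U : set L).

Definition sublocale S : Prop :=
  (forall A : set L, A `<=` S -> S (bigmeet A)) /\
  (forall a s, S s -> S (heyting a s)).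

Definition closed_sl a : set L := [set x | a <= x].
Definition open_sl a : set L := [set x | heyting a x = x].

(* The lattice of sublocales, ordered by inclusion, has bottom [set \top],
   top setT, and meet given by intersection. *)
Definition sl_join S T : set L :=
  \bigcap_(U in [set U | sublocale U /\ (S `|` T `<=` U)%classic]) U.

Definition sl_is_compl S T : Prop :=
  [/\ sublocale T, (S `&` T)%classic = [set \top] & sl_join S T = setT].

(* The value setT is junk, for S without a complement. *)
Definition sl_compl S : set L := xget setT (sl_is_compl S).

Definition closure_sl S : set L := closed_sl (bigmeet S).
Definition interior_sl S : set L := open_sl (bigjoin [set a | open_sl a `<=` S]).

Lemma heyting_mp a x : heyting a x `&` a <= x.
Proof. by rewrite -heytingP. Qed.

Lemma le_heyting a x : x <= heyting a x.
Proof. by rewrite heytingP leIl. Qed.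

Lemma closed_sl_sublocale a : sublocale (closed_sl a).
Proof.
split=> [A Aa|b s sa]; first by apply: bigmeet_ge => x /Aa.
exact: le_trans sa (le_heyting _ _).
Qed.

Lemma open_sl_sublocale a : sublocale (open_sl a).
Proof.
split=> [A Aa|b s /= sa]; apply/eqP; rewrite eq_le le_heyting andbT.
  apply: bigmeet_ge => x Ax; rewrite -(Aa x Ax) heytingP.
  by apply: le_trans (bigmeet_lb Ax); exact: heyting_mp.
rewrite heytingP -[leRHS]sa heytingP -meetA (meetC b) meetA.
by apply: le_trans (heyting_mp b s); rewrite leI2 ?heyting_mp.
Qed.

Lemma bigmeet_closed_sl a : bigmeet (closed_sl a) = a.
Proof.
by apply/eqP; rewrite eq_le bigmeet_lb /closed_sl ?lexx //= bigmeet_ge.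
Qed.

Lemma open_closed_meet a x : heyting a x `&` (a `|` x) = x.
Proof.
apply/eqP; rewrite eq_le lexI le_heyting leUr /= andbT meetC -heytingP leUx.
by rewrite !heytingP leIl andbT meetC heyting_mp.
Qed.

Lemma open_sl_heyting a x : open_sl a (heyting a x).
Proof.
apply/eqP; rewrite eq_le le_heyting andbT heytingP.
by apply: le_trans (heyting_mp a x); rewrite lexI heyting_mp leIr.
Qed.

Lemma sl_joinP S T x : sublocale S -> sublocale T ->
  sl_join S T x <-> exists2 s, S s & exists2 t, T t & x = s `&` t.
Proof.
move=> [Sm Sh] [Tm Th]; have top V : sublocale V -> V \top.
  case=> Vm _; have := Vm set0 (@sub0set _ _).
  suff -> : bigmeet set0 = \top :> L by [].
  by apply/eqP; rewrite -le1x bigmeet_ge.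
split=> [STx|[s Ss [t Tt ->]] U [[Um _] STU]]; last first.
  have -> : s `&` t = bigmeet [set s; t].
    apply/eqP; rewrite eq_le lexI !bigmeet_lb ?andbT; [|by right|by left].
    by apply: bigmeet_ge => _ [] ->; rewrite ?leIl ?leIr.
  by apply: Um => _ [] ->; apply: STU; [left|right].
apply: (STx [set x | exists2 s, S s & exists2 t, T t & x = s `&` t]).
split; last first.
  move=> y [Sy|Ty]; [exists y => //; exists \top|exists \top; last exists y] => //.
  - exact: top.
  - by rewrite meetx1.
  - exact: top.
  - by rewrite meet1x.
split=> [A AU|b _ [s Ss [t Tt ->]]].
  exists (bigmeet (S `&` ubound [set bigmeet A]))%classic.
    by apply: Sm => ? [].
  exists (bigmeet (T `&` ubound [set bigmeet A]))%classic.
    by apply: Tm => ? [].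
  apply/eqP; rewrite eq_le lexI; apply/andP; split.
    by apply/andP; split; apply: bigmeet_ge => y [_]; apply.
  apply: bigmeet_ge => x' Ax; have [s Ss [t Tt xE]] := AU _ Ax.
  have le_x := bigmeet_lb Ax; rewrite xE lexI in le_x.
  case/andP: le_x => le_s le_t; rewrite xE leI2 //.
    by apply: bigmeet_lb; split=> // _ ->.
  by apply: bigmeet_lb; split=> // _ ->.
exists (heyting b s); first exact: Sh.
exists (heyting b t); first exact: Th.
have := heyting_mp b (s `&` t); rewrite lexI => /andP[bs bt].
apply/eqP; rewrite eq_le lexI !heytingP bs bt /= lexI; apply/andP; split.
  by apply: le_trans (heyting_mp b s); exact: leI2 (leIl _ _) (lexx b).
by apply: le_trans (heyting_mp b t); exact: leI2 (leIr _ _) (lexx b).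
Qed.

Lemma open_sl_compl a : sl_is_compl (open_sl a) (closed_sl a).
Proof.
split; first exact: closed_sl_sublocale.
- apply/seteqP; split=> x /=.
    case=> xa; rewrite /closed_sl /= => ax; apply/eqP.
    by rewrite -le1x -[leRHS]xa heytingP meet1x.
  move=> ->; split; last exact: lex1.
  by apply/eqP; rewrite -le1x le_heyting.
- apply/seteqP; split=> // x _; apply/sl_joinP.
  + exact: open_sl_sublocale.
  + exact: closed_sl_sublocale.
  + exists (heyting a x); first exact: open_sl_heyting.
    by exists (a `|` x); [exact: leUl | rewrite open_closed_meet].
Qed.

Lemma sl_compl_open a : sl_compl (open_sl a) = closed_sl a.
Proof.
apply: xget_unique; first exact: open_sl_compl.
move=> T [slT oT oTj]; apply/seteqP; split=> t.
  move=> Tt; have : (open_sl a `&` T)%classic (heyting a t).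
    by split; [exact: open_sl_heyting | exact: slT.2].
  by rewrite oT => /= at1; rewrite /closed_sl /= -[a]meet1x -at1 heyting_mp.
move=> at_; have : sl_join (open_sl a) T t by rewrite oTj.
move/(sl_joinP _ (open_sl_sublocale a) slT) => [u ua [v Tv tE]].
suff u1 : u = \top by rewrite tE u1 meet1x.
apply/eqP; rewrite -le1x -[leRHS]ua heytingP meet1x.
by apply: le_trans at_ _; rewrite tE leIl.
Qed.

Record closedSub := ClosedSub {
  closedSub_set :> set L ;
  _ : closedSub_set \in range closed_sl
}.

HB.instance Definition _ := [isSub for closedSub_set].
HB.instance Definition _ := [Choice of closedSub by <:].
HB.instance Definition _ :=
  [SubChoice_isSubPOrder of closedSub by <: with set_display].

Lemma closed_sl_range a : closed_sl a \in range closed_sl.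
Proof. by rewrite inE; exists a. Qed.

Definition closed_of a : closedSub := ClosedSub (closed_sl_range a).

Lemma closure_range S : closure_sl S \in range closed_sl.
Proof. exact: closed_sl_range. Qed.

Lemma compl_interior_range S : sl_compl (interior_sl S) \in range closed_sl.
Proof. by rewrite sl_compl_open closed_sl_range. Qed.

(* The a such that C is the closed sublocale of a; see closed_ofK. *)
Definition generator (C : closedSub) : L := bigmeet C.

Lemma closed_ofK : cancel closed_of generator.
Proof. by move=> a; exact: bigmeet_closed_sl. Qed.

Lemma generatorK : cancel generator closed_of.
Proof.
case=> S SP; apply: val_inj; have := SP; rewrite inE => -[a _ aS] /=.
by rewrite /generator /= -aS bigmeet_closed_sl.
Qed.

Lemma closedSub_leE (C D : closedSub) :
  (C <= D) <-> (C `<=` D)%classic.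
Proof. by rewrite -Order.le_val subsetEset. Qed.

End Sublocales.

Section InducedMaps.
Context dL (L : localeType dL) dM (M : localeType dM) (f : L -> M).

Definition open_map : Prop :=
  forall a : L, exists b : M, f @` open_sl a = open_sl b.

Definition fc_image (C : closedSub L) : closedSub M :=
  ClosedSub (closure_range (f @` C)).

Definition fc_preimage (D : closedSub M) : closedSub L :=
  ClosedSub (closure_range (f @^-1` D)).

Definition fc_coimage (C : closedSub L) : closedSub M :=
  ClosedSub (compl_interior_range (f @` open_sl (generator C))).

Lemma fc_imageE a : fc_image (closed_of a) = closure_sl (f @` closed_sl a) :> set _.
Proof. by []. Qed.

Lemma fc_preimageE b :
  fc_preimage (closed_of b) = closure_sl (f @^-1` closed_sl b) :> set _.
Proof. by []. Qed.

Lemma fc_coimageE a :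
  fc_coimage (closed_of a) = sl_compl (interior_sl (f @` open_sl a)) :> set _.
Proof. by rewrite /= closed_ofK. Qed.

End InducedMaps.

(* Main.v *)
Require Import Defs.
From mathcomp Require Import all_boot all_order.
From mathcomp Require Import mathcomp_extra boolp classical_sets.

(** Identify [c(a)] with [a], which reverses the order. The three maps become
  [p a = /\ f[c(a)]], [q a = \/ {b | o(b) <= f[o(a)]}] on [L] and
  [g b = /\ f^-1[c(b)]] on [M], and the chain of adjunctions reads
  [q -| g -| p]. The first half forces [f = p]: if [b = f x] then [g b <= x],
  so [f x <= p x], while [p x <= f x] always holds. Both halves together make
  [g] preserve joins and finite meets, so [f] is localic. Then
  [f (g b -> x) = b -> f x] links [a <= g b] to [f[o(a)] <= o(b)], and
  since [f] preserves meets, [o(q a) <= f[o(a)]]. *)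

Set Implicit Arguments.
Unset Strict Implicit.
Unset Printing Implicit Defensive.

Import Order.TTheory.
Local Open Scope classical_set_scope.
Local Open Scope order_scope.

Section Locale.
Context d (L : localeType d).
Implicit Types a b x : L.

Lemma closed_of_le a b : (closed_of a <= closed_of b) <-> (b <= a).
Proof.
rewrite closedSub_leE; split=> [sub|ba x]; first exact: sub (lexx a).
exact: le_trans.
Qed.

Lemma open_sl_le a b : (open_sl a `<=` open_sl b)%classic <-> (a <= b).
Proof.
split=> [sub|ab x xa].
  (* Test the inclusion at [heyting a b]. Since [b <= heyting a b], its being fixed by [heyting b]
     forces it to be [\top]. *)
  have /sub bab := open_sl_heyting a b.
  rewrite -[a]meet1x -heytingP -[leRHS]bab heytingP meet1x.
  exact: le_heyting.
apply/eqP; rewrite eq_le le_heyting andbT -[leRHS]xa heytingP.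
by apply: le_trans (heyting_mp b x); exact: leI2 (lexx _) ab.
Qed.

Lemma heyting_bigjoin (A : set L) x :
  heyting (bigjoin A) x = bigmeet [set heyting a x | a in A].
Proof.
apply/eqP; rewrite eq_le; apply/andP; split.
  apply: bigmeet_ge => _ [a Aa <-]; rewrite heytingP.
  apply: le_trans (heyting_mp (bigjoin A) x).
  exact: leI2 (lexx _) (bigjoin_ub Aa).
rewrite heytingP meetC bigjoin_meetl; apply: bigjoin_le => _ [a Aa <-].
by rewrite meetC -heytingP; apply: bigmeet_lb; exists a.
Qed.

End Locale.

Section Galois.
Context dX (X : completeLatticeType dX) dY (Y : completeLatticeType dY).
Context (g : X -> Y) (h : Y -> X) (gh : galois g h).

Lemma galois_bigjoin (A : set X) : g (bigjoin A) = bigjoin (g @` A).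
Proof.
apply/eqP; rewrite eq_le; apply/andP; split.
  apply/gh; apply: bigjoin_le => x Ax; apply/gh.
  by apply: bigjoin_ub; exists x.
apply: bigjoin_le => _ [x Ax <-]; apply: (galois_homo gh).1.
exact: bigjoin_ub.
Qed.

Lemma galois_bigmeet (A : set Y) : h (bigmeet A) = bigmeet (h @` A).
Proof.
apply/eqP; rewrite eq_le; apply/andP; split.
  apply: bigmeet_ge => _ [y Ay <-]; apply: (galois_homo gh).2.
  exact: bigmeet_lb.
apply/gh; apply: bigmeet_ge => y Ay; apply/gh.
by apply: bigmeet_lb; exists y.
Qed.

Lemma galois_bot : g \bot = \bot.
Proof. by apply/eqP; rewrite -lex0; apply/gh; exact: le0x. Qed.

Lemma galois_top : h \top = \top.
Proof. by apply/eqP; rewrite -le1x; apply/gh; exact: lex1. Qed.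

Lemma galois_meet : {morph h : x y / x `&` y}.
Proof.
move=> x y; apply/eqP; rewrite eq_le lexI !(galois_homo gh).2 ?leIl ?leIr //=.
by apply/gh; rewrite lexI; apply/andP; split; apply/gh; rewrite ?leIl ?leIr.
Qed.

End Galois.

Section InducedMaps.
Context dL (L : localeType dL) dM (M : localeType dM) (f : L -> M).
Implicit Types (a x : L) (b y : M).

Definition gen_image a : M := bigmeet (f @` closed_sl a).
Definition gen_preimage b : L := bigmeet (f @^-1` closed_sl b).
Definition gen_coimage a : M :=
  bigjoin [set b | (open_sl b `<=` f @` open_sl a)%classic].

Lemma fc_image_closed_of a :
  fc_image f (closed_of a) = closed_of (gen_image a).
Proof. exact: val_inj. Qed.

Lemma fc_preimage_closed_of b :
  fc_preimage f (closed_of b) = closed_of (gen_preimage b).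
Proof. exact: val_inj. Qed.

Lemma fc_coimage_closed_of a :
  fc_coimage f (closed_of a) = closed_of (gen_coimage a).
Proof. by apply: val_inj; rewrite /= closed_ofK sl_compl_open. Qed.

Lemma galois_fc_image :
  galois (fc_image f) (fc_preimage f) <-> galois gen_preimage gen_image.
Proof.
split=> [gal b a|gal C D].
  have := gal (closed_of a) (closed_of b).
  rewrite fc_image_closed_of fc_preimage_closed_of !closed_of_le.
  exact: iff_sym.
rewrite -(generatorK C) -(generatorK D).
rewrite fc_image_closed_of fc_preimage_closed_of !closed_of_le.
exact: iff_sym (gal _ _).
Qed.

Lemma galois_fc_coimage :
  galois (fc_preimage f) (fc_coimage f) <-> galois gen_coimage gen_preimage.
Proof.
split=> [gal a b|gal C D].
  have := gal (closed_of b) (closed_of a).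
  rewrite fc_coimage_closed_of fc_preimage_closed_of !closed_of_le.
  exact: iff_sym.
rewrite -(generatorK C) -(generatorK D).
rewrite fc_coimage_closed_of fc_preimage_closed_of !closed_of_le.
exact: iff_sym (gal _ _).
Qed.

Lemma gen_image_homo : {homo f : x y / x <= y} -> gen_image = f.
Proof.
move=> f_homo; apply/funext => a; apply/eqP; rewrite eq_le; apply/andP; split.
  by apply: bigmeet_lb; exists a => //; exact: lexx.
by apply: bigmeet_ge => _ [x ax <-]; exact: f_homo.
Qed.

(** By adjointness the preimage of c(b) under [f] is c([g b]), whose meet is [g b]. *)
Lemma gen_preimage_galois (g : M -> L) : galois g f -> gen_preimage = g.
Proof.
move=> gf; apply/funext => b; rewrite -[RHS]bigmeet_closed_sl.
by congr bigmeet; apply/seteqP; split=> x /gf.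
Qed.

Lemma galois_gen_image : galois gen_preimage gen_image -> gen_image = f.
Proof.
move=> gal; apply/funext => a; apply/eqP; rewrite eq_le; apply/andP; split.
  by apply: bigmeet_lb; exists a => //; exact: lexx.
by apply/gal; apply: bigmeet_lb; exact: lexx.
Qed.

Lemma gen_coimage_open a b : f @` open_sl a = open_sl b -> gen_coimage a = b.
Proof.
move=> fab; apply/eqP; rewrite eq_le; apply/andP; split.
  by apply: bigjoin_le => c /=; rewrite fab => /open_sl_le.
by apply: bigjoin_ub; rewrite /= fab.
Qed.

Section LeftAdjoint.
Context (g : M -> L) (g_meet : {morph g : x y / x `&` y}) (gf : galois g f).

(** An element [c] is below either side exactly when the meet of [g c] and [g b] is below [x]. *)
Lemma galois_heyting b x : f (heyting (g b) x) = heyting b (f x).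
Proof.
apply/eqP; rewrite eq_le; apply/andP; split.
  rewrite heytingP; apply/gf; rewrite g_meet -heytingP.
  by apply/gf; exact: lexx.
by apply/gf; rewrite heytingP -g_meet; apply/gf; exact: heyting_mp.
Qed.

Lemma image_open_sub a b : g \top = \top ->
  (f @` open_sl a `<=` open_sl b)%classic <-> (a <= g b).
Proof.
move=> g1; split=> [sub|agb _ [x xa <-]].
  (* [a -> g b] is in [o(a)], and [f] sends it to [\top]. *)
  have /sub : (f @` open_sl a)%classic (f (heyting a (g b))).
    by exists (heyting a (g b)) => //; exact: open_sl_heyting.
  rewrite /open_sl /= -galois_heyting => fE.
  rewrite -[a]meet1x -heytingP -g1; apply/gf; rewrite -fE; apply/gf.
  by rewrite g1 heytingP meet1x le_heyting.
(* It remains that [heyting (g b) x = x], which holds because o(a) lies in o([g b]). *)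
rewrite /open_sl /= -galois_heyting; congr f.
exact: (open_sl_le a (g b)).2 agb _ xa.
Qed.

End LeftAdjoint.

(** A mere subset need not contain its interior. Here it does: o(a) is closed under meets and [f]
    preserves them, so f[o(a)] is closed under meets. *)
Lemma open_gen_coimage_sub (g : M -> L) a :
  galois g f -> (open_sl (gen_coimage a) `<=` f @` open_sl a)%classic.
Proof.
move=> gf y yq.
(* The preimage of [y] is the least member of o(a) whose image is above [y]. *)
pose X := [set x | open_sl a x /\ y <= f x].
exists (bigmeet X); first by apply: (open_sl_sublocale a).1 => x [].
rewrite (galois_bigmeet gf); apply/eqP; rewrite eq_le; apply/andP; split.
  (* As [y] is in o([gen_coimage f a]), it is the meet of the elements [heyting b y] with o(b)
     inside f[o(a)]; each of these is the image of a member of [X]. *)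
  rewrite -[leRHS]yq heyting_bigjoin; apply: bigmeet_ge => _ [b sub <-].
  have [x xa fx] := sub _ (open_sl_heyting b y).
  rewrite -fx; apply: bigmeet_lb; exists x => //.
  by split=> //; rewrite fx le_heyting.
by apply: bigmeet_ge => _ [x [_ yx] <-].
Qed.

End InducedMaps.

Theorem corollary3p4p4 (dL dM : Order.disp_t)
    (L : localeType dL) (M : localeType dM) (f : L -> M) :
  (localic_map f /\ open_map f) <->
  (galois (fc_image f) (fc_preimage f) /\
   galois (fc_preimage f) (fc_coimage f)).
Proof.
rewrite galois_fc_image galois_fc_coimage; split.
  move=> [[g [_ _ g1 gI] gf] f_open].
  rewrite (gen_preimage_galois gf) (gen_image_homo (galois_homo gf).2).
  split=> // a b; have [c fac] := f_open a.
  (* With f[o(a)] = o(c), the left side [c <= b] of the adjunction says that f[o(a)] lies in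
     o(b). *)
  rewrite (gen_coimage_open fac) -open_sl_le -fac.
  exact: image_open_sub gI gf _ _ g1.
move=> [gp qg]; have gf := gp; rewrite (galois_gen_image gp) in gf.
(* Finite meets are preserved because [gen_preimage f] is also a right adjoint, of
   [gen_coimage f]. *)
have gI := galois_meet qg; have g1 := galois_top qg.
split.
  exists (gen_preimage f); last exact: gf.
  split; [exact: galois_bigjoin gf|exact: galois_bot gf|exact: g1|exact: gI].
move=> a; exists (gen_coimage f a); apply/seteqP; split.
  (* This inclusion amounts to the unit of the adjunction [qg] at [a]. *)
  apply: (image_open_sub gI gf _ _ g1).2; apply/qg; exact: lexx.
exact: open_gen_coimage_sub gf.
Qed.
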